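(* Let $S$ be a semigroup with finite kernel $K=(G,\mathbf{P},\Lambda,I)$. Then $S$ is an equational domain in the language $\mathcal{L}_S$ if and only if the following two conditions hold: 1. the kernel $K$ is an equational domain in the language $\mathcal{L}_K$; 2. the equivalence relation $\sim_K$ on $S$ is trivial.
   Context: Equational domains. For a semigroup $T$, the language $\mathcal{L}_T$ consists of the multiplication symbol together with a constant symbol for every element of $T$. An $\mathcal{L}_T$-term in the variables $x_1,\dots,x_n$ is a nonempty finite product of variables and constants from $T$. An equation over $\mathcal{L}_T$ is an equality $t=s$ of two $\mathcal{L}_T$-terms, and a system is an arbitrary set of equations in the variables $x_1,\dots,x_n$ ($n$ finite). A subset of $T^n$ is algebraic over $\mathcal{L}_T$ if it is the set of all solutions in $T^n$ of some system over $\mathcal{L}_T$. The semigroup $T$ is an equational domain (e.d.) in the language $\mathcal{L}_T$ if for all $n$ every union $Y_1\cup\dots\cup Y_m$ of finitely many ($m\ge 1$) algebraic subsets of $T^n$ is algebraic. Kernels. The kernel of a semigroup $S$ is its minimal two-sided ideal, if it exists. Kernels are assumed to be completely simple (a finite kernel always is). By the Sushkevich–Rees theorem a completely simple semigroup $K$ is identified with the set of triples $(\lambda,g,i)$, $\lambda\in\Lambda$, $g\in G$, $i\in I$, with multiplication $(\lambda,g,i)(\mu,h,j)=(\lambda,g\,p_{i\mu}h,j)$, where $G$ is a group, $\Lambda,I$ are nonempty index sets each with a distinguished element $1$, and $\mathbf{P}=(p_{i\mu})_{i\in I,\mu\in\Lambda}$ is a matrix with entries in $G$ that is normalized: $p_{1\mu}=p_{i1}=1$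 for all $\mu\in\Lambda$, $i\in I$. This is written $K=(G,\mathbf{P},\Lambda,I)$. For $\alpha,\beta\in S$ write $\alpha\sim_K\beta$ if $\alpha x=\beta x$ and $x\alpha=x\beta$ for all $x\in K$. The relation $\sim_K$ is trivial if $\alpha\sim_K\beta$ implies $\alpha=\beta$. *)

(* Defs.v *)
From HB Require Import structures.
From mathcomp Require Import all_boot.
From mathcomp Require Import boolp classical_sets functions cardinality.

Set Implicit Arguments.
Unset Strict Implicit.
Unset Printing Implicit Defensive.

Local Open Scope classical_set_scope.
Local Open Scope group_scope.

(* Terms carry a bracketing; it has no effect on values, as the
   multiplication of a semigroup is associative. *)
Inductive term (T : Type) (n : nat) : Type :=
| TVar of 'I_n
| TConst of T
| TMul of term T n & term T n.

Fixpoint eval (T : semigroupType) (n : nat) (x : 'I_n -> T) (t : term T n) : T :=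
  match t with
  | TVar i => x i
  | TConst c => c
  | TMul t1 t2 => eval x t1 * eval x t2
  end.

Definition equation (T : Type) (n : nat) : Type := (term T n * term T n)%type.

Definition solutions (T : semigroupType) (n : nat) (E : set (equation T n)) :
    set ('I_n -> T) :=
  [set x | forall e, E e -> eval x e.1 = eval x e.2].

Definition algebraic (T : semigroupType) (n : nat) (Y : set ('I_n -> T)) : Prop :=
  exists E : set (equation T n), Y = solutions E.

Definition equational_domain (T : semigroupType) : Prop :=
  forall (n m : nat) (Y : 'I_m -> set ('I_n -> T)),
    (0 < m)%N -> (forall j, algebraic (Y j)) -> algebraic (\bigcup_j Y j).

Definition is_ideal (S : semigroupType) (J : set S) : Prop :=
  J !=set0 /\ forall s x, J x -> J (s * x) /\ J (x * s).

Definition is_kernel (S : semigroupType) (K : set S) : Prop :=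
  is_ideal K /\ forall J, is_ideal J -> J `<=` K -> J = K.

Definition simK (S : semigroupType) (K : set S) (a b : S) : Prop :=
  forall x, K x -> a * x = b * x /\ x * a = x * b.

Definition rees (G : groupType) (Lam I : choiceType) (P : I -> Lam -> G) : Type :=
  (Lam * G * I)%type.

Section ReesSemigroup.
Variables (G : groupType) (Lam I : choiceType) (P : I -> Lam -> G).

HB.instance Definition _ := Choice.on (rees P).

Definition rees_mul (a b : rees P) : rees P :=
  let: (l, g, i) := a in
  let: (m, h, j) := b in
  (l, g * P i m * h, j).

Lemma rees_mulA : associative rees_mul.
Proof. by move=> [[l g] i] [[m h] j] [[k f] r]; rewrite /= !mulgA. Qed.

HB.instance Definition _ := isSemigroup.Build (rees P) rees_mulA.

End ReesSemigroup.

Definition normalized (G : groupType) (Lam I : Type) (l1 : Lam) (i1 : I)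
    (P : I -> Lam -> G) : Prop :=
  (forall m, P i1 m = 1) /\ (forall i, P i l1 = 1).

(* Main.v *)
Require Import Defs.
From HB Require Import structures.
From mathcomp Require Import all_boot.
From mathcomp Require Import boolp classical_sets functions cardinality.

(** Being an equational domain amounts to a separation property: for all
    [a <> b] and [c <> d], one equation in four variables holds whenever
    [x = y] or [z = w], but fails at [(a, b, c, d)].  Such an equation acts as
    a disjunction: substituting the two sides of two equations for its
    variables merges them into one, so finite unions of solution sets remain
    solution sets.

    The separation property climbs along an injective morphism [f : U -> T] as
    soon as distinct points of [T] can be told apart by unary terms with values
    in the image of [f] ([separating_transfer]).  This is used twice.
    - From [K] to [S]: if [simK] is trivial, some [x |-> k * x] or
      [x |-> x * k] with [k] in [K] tells two given points apart.
    - From [G] to [K]: if no two rows and no two columns of [P] coincide, some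
      [x |-> l * x * r] with values in the subgroup [(l1, G, i1)] does.
    A finite group without zero divisors, i.e. such that any nontrivial [u] and
    [v] fail to commute after some conjugation of [v], is separating: take the
    equation saying that [x / y] and [(z / w) ^ g] commute, division being a
    term because the group has finite exponent.

    So, if [S] is an equational domain, it suffices to prove that [simK] is
    trivial, that [P] has neither repeated rows nor repeated columns, and that
    [G] has no zero divisors.  Each failure would produce [a <> b] and
    [c <> d] for which every binary term, restricted to the square
    {a, b} x {c, d}, is so rigid that two terms that agree on three
    corners also agree on the fourth, whereas in an equational domain the union
    of [x = a] and [y = c] must be cut out by equations.  The rigidity comes from
    the kernel being an ideal: a factor in [K] hides from what it multiplies
    everything but the action on [K].  This gives [ideal_left_faithful]
    (elements acting equally on an ideal from the left are equal), which
    covers both [simK] and the rows, and by passing to the opposite semigroup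
    the columns; for the zero divisors, terms turn out to be affine in the
    middle Rees coordinate. *)

Local Open Scope classical_set_scope.
Local Open Scope group_scope.

Set Implicit Arguments.
Unset Strict Implicit.
Unset Printing Implicit Defensive.

(** * Terms and separating equations *)

(** Translates constants along [f] and substitutes [sigma] for the variables at
    once, so that one evaluation lemma serves both substitution inside a
    semigroup ([f] the identity) and transport along a morphism. *)
Fixpoint inst (U T : Type) (n m : nat) (f : U -> T) (sigma : 'I_n -> term T m)
    (t : term U n) : term T m :=
  match t with
  | TVar i => sigma i
  | TConst c => TConst m (f c)
  | TMul t1 t2 => TMul (inst f sigma t1) (inst f sigma t2)
  end.

Lemma eval_inst (U T : semigroupType) (n m : nat) (f : {multiplicative U -> T})
    (sigma : 'I_n -> term T m) (z : 'I_n -> U) (x : 'I_m -> T) (t : term U n) :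
  (forall i, eval x (sigma i) = f (z i)) ->
  eval x (inst f sigma t) = f (eval z t).
Proof. by move=> xz; elim: t => //= t1 -> t2 ->; rewrite gmulfM. Qed.

(** An algebraic set is defined by all the equations valid on it, so only the
    points outside need to be examined. *)
Lemma algebraicP (T : semigroupType) (n : nat) (Y : set ('I_n -> T)) :
  algebraic Y <->
  forall x, ~ Y x -> exists t s : term T n,
    eval x t <> eval x s /\ forall y, Y y -> eval y t = eval y s.
Proof.
split=> [[E ->] x xE | sep].
  have [e /not_implyP[Ee xe]] : exists e, ~ (E e -> eval x e.1 = eval x e.2).
    exact/existsNP.
  by exists e.1, e.2; split=> // y; apply.
exists [set e | forall y, Y y -> eval y e.1 = eval y e.2].
apply/seteqP; split=> x /= Yx; first by move=> e; apply.
apply: contrapT => /sep[t [s [xts Yts]]].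
exact/xts/(Yx (t, s)).
Qed.

Definition vec4 (T : Type) (a b c d : T) (i : 'I_4) : T :=
  nth a [:: a; b; c; d] i.

Definition separating (T : semigroupType) : Prop :=
  forall a b c d : T, a <> b -> c <> d -> exists t s : term T 4,
    eval (vec4 a b c d) t <> eval (vec4 a b c d) s /\
    forall x y z w, x = y \/ z = w ->
      eval (vec4 x y z w) t = eval (vec4 x y z w) s.

Lemma algebraic_eq (T : semigroupType) (n : nat) (t s : term T n) :
  algebraic [set x | eval x t = eval x s].
Proof.
exists [set (t, s)]; apply/seteqP; split=> x /=; first by move=> ts _ ->.
by move=> /(_ (t, s) erefl).
Qed.

Lemma algebraicU (T : semigroupType) (n : nat) (Y Z : set ('I_n -> T)) :
  equational_domain T -> algebraic Y -> algebraic Z -> algebraic (Y `|` Z).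
Proof.
move=> edT algY algZ.
have -> : Y `|` Z = \bigcup_(j : 'I_2) (if j == ord0 then Y else Z).
  apply/seteqP; split=> x; first by case=> [Yx|Zx]; [exists ord0|exists ord_max].
  by case=> j _; case: ifP; [left|right].
by apply: edT => // j; case: ifP.
Qed.

Lemma equational_domain_separating (T : semigroupType) :
  equational_domain T -> separating T.
Proof.
move=> edT a b c d neq_ab neq_cd.
pose X (i : nat) (lt_i : (i < 4)%N) := TVar T (Ordinal lt_i).
have /algebraicP sep := algebraicU edT
  (algebraic_eq (X 0%N isT) (X 1%N isT)) (algebraic_eq (X 2%N isT) (X 3%N isT)).
have [|t [s [neq eq_ts]]] := sep (vec4 a b c d); first by case.
by exists t, s; split=> // x y z w xyzw; apply: eq_ts.
Qed.

(** The separating equation for the values of the four sides at [x], with these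
    four sides substituted for its variables. *)
Lemma merge_equations (T : semigroupType) (n : nat) (x : 'I_n -> T)
    (t1 s1 t2 s2 : term T n) :
  separating T -> eval x t1 <> eval x s1 -> eval x t2 <> eval x s2 ->
  exists t s : term T n, eval x t <> eval x s /\
    forall y, eval y t1 = eval y s1 \/ eval y t2 = eval y s2 ->
      eval y t = eval y s.
Proof.
move=> sepT neq1 neq2; have [t [s [neq eq_ts]]] := sepT _ _ _ _ neq1 neq2.
have evE y r : eval y (inst idfun (vec4 t1 s1 t2 s2) r) =
    eval (vec4 (eval y t1) (eval y s1) (eval y t2) (eval y s2)) r.
  by apply: eval_inst; case=> [[|[|[|[|]]]]].
exists (inst idfun (vec4 t1 s1 t2 s2) t), (inst idfun (vec4 t1 s1 t2 s2) s).
by split=> [|y ts]; rewrite !evE //; apply: eq_ts.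
Qed.

Lemma separating_equational_domain (T : semigroupType) :
  separating T -> equational_domain T.
Proof.
move=> sepT n [//|m] Y _ algY; apply/algebraicP => x Yx.
have {Yx algY}/choice[E EP] : forall j, exists e : equation T n,
    eval x e.1 <> eval x e.2 /\ forall y, Y j y -> eval y e.1 = eval y e.2.
  move=> j; have /algebraicP sepj := algY j.
  by have [Yj|t [s ts]] := sepj x; [apply: Yx; exists j|exists (t, s)].
have [t [s [neq eq_ts]]] : exists t s : term T n, eval x t <> eval x s /\
    forall y j, Y j y -> eval y t = eval y s.
  elim: m Y E EP => [|m IHm] Y E EP.
    have [neq eqE] := EP ord0.
    by exists (E ord0).1, (E ord0).2; split=> // y j; rewrite [j]ord1; apply: eqE.
  have [t [s [neq eq_ts]]] := IHm _ _ (fun j => EP (lift ord0 j)).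
  have [neq0 eq0] := EP ord0.
  have [t' [s' [neq' eq']]] := merge_equations sepT neq0 neq.
  exists t', s'; split=> // y j Yjy; apply: eq'.
  case: (unliftP ord0 j) Yjy => [j' ->|->] Yjy; last by left; apply: eq0.
  by right; apply: eq_ts Yjy.
by exists t, s; split=> // y [j _]; apply: eq_ts.
Qed.

(** The separating equation in [U] for the images of the four points under the
    unary terms is pulled back through these terms.  It remains valid when
    [x = y] or [z = w] because equal arguments have equal images. *)
Lemma separating_transfer (U T : semigroupType) (f : {multiplicative U -> T}) :
  injective f ->
  (forall a b : T, a <> b -> exists t : term T 1,
     eval (fun=> a) t <> eval (fun=> b) t /\
     forall x, range f (eval (fun=> x) t)) ->
  separating U -> separating T.
Proof.
move=> injf retract sepU a b c d.
move=> /retract[t1 [neq1 im1]] /retract[t2 [neq2 im2]].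
have {im1}/choice[p1 p1E] x : exists u, f u = eval (fun=> x) t1.
  by have [u] := im1 x; exists u.
have {im2}/choice[p2 p2E] x : exists u, f u = eval (fun=> x) t2.
  by have [u] := im2 x; exists u.
have neq1' : p1 a <> p1 b by move=> p_ab; apply: neq1; rewrite -!p1E p_ab.
have neq2' : p2 c <> p2 d by move=> p_cd; apply: neq2; rewrite -!p2E p_cd.
have [t [s [neq eq_ts]]] := sepU _ _ _ _ neq1' neq2'.
pose sub r i lt_i := inst idfun (fun _ : 'I_1 => TVar T (@Ordinal 4 i lt_i)) r.
pose sigma := vec4 (sub t1 0%N isT) (sub t1 1%N isT) (sub t2 2%N isT) (sub t2 3%N isT).
have evE x y z w r : eval (vec4 x y z w) (inst f sigma r) =
    f (eval (vec4 (p1 x) (p1 y) (p2 z) (p2 w)) r).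
  apply: eval_inst.
  by case=> [[|[|[|[|]]]]] //= lti; rewrite /sigma /vec4 /= ?p1E ?p2E;
    apply: eval_inst.
exists (inst f sigma t), (inst f sigma s).
split=> [|x y z w xyzw]; rewrite !evE; first by move/injf.
by congr (f _); apply: eq_ts; case: xyzw => ->; [left|right].
Qed.

(** * Groups and Rees matrix semigroups *)

(** Equivalently, the normal closures of two nontrivial elements never
    centralize each other. *)
Definition no_zero_divisors (G : groupType) : Prop :=
  forall u v : G, (forall g, commute u (v ^ g)) -> u = 1 \/ v = 1.

(** Semigroup terms cannot invert a variable; in a finite group a fixed positive
    power does. *)
Lemma finite_group_invg_exp (G : groupType) :
  finite_set [set: G] -> exists k, forall g : G, g ^+ k.+1 = g^-1.
Proof.
move=> /finite_seqP[r rE].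
have mem_r (g : G) : g \in r by move: (I : [set: G] g); rewrite rE.
have torsion (g : G) : g ^+ (size r)`! = 1.
  have : ~~ uniq [seq g ^+ i | i <- iota 0 (size r).+1].
    apply/negP => /uniq_leq_size/(_ (fun x _ => mem_r x)).
    by rewrite size_map size_iota ltnn.
  case/(uniqPn 1) => i [j []]; rewrite size_map size_iota => lt_ij lt_jr.
  rewrite !(nth_map 0%N) ?size_iota ?(ltn_trans lt_ij) // !nth_iota //;
    last exact: ltn_trans lt_ij lt_jr.
  rewrite !add0n -(subnKC (ltnW lt_ij)) expgnDr -{1}[g ^+ i]mulg1.
  move=> /mulgI gji.
  have /dvdn_fact/dvdnP[q ->] : (0 < j - i <= size r)%N.
    by rewrite subn_gt0 lt_ij (leq_trans (leq_subr _ _)).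
  by rewrite mulnC expgnA -gji expg1n.
have fact2 : (2 <= (size r)`! + (size r)`!)%N.
  by rewrite (leq_add (fact_gt0 _) (fact_gt0 _)).
(* The factorial itself may be 1, and truncated subtraction of 2 would then give
   a wrong exponent; hence the doubling. *)
exists ((size r)`! + (size r)`! - 2)%N => g.
apply/esym/mulg1_eq.
by rewrite -expgS -[X in _ ^+ X]addn2 subnK // expgnDr torsion mulg1.
Qed.

(** [t] to the power [k.+1], as there is no empty term. *)
Fixpoint tpow (T : Type) (n : nat) (t : term T n) (k : nat) : term T n :=
  if k is k'.+1 then TMul t (tpow t k') else t.

Lemma eval_tpow (G : groupType) (n : nat) (x : 'I_n -> G) (t : term G n) (k : nat) :
  eval x (tpow t k) = eval x t ^+ k.+1.
Proof. by elim: k => //= k ->; rewrite -expgS. Qed.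

Lemma finite_group_separating (G : groupType) :
  finite_set [set: G] -> no_zero_divisors G -> separating G.
Proof.
move=> /finite_group_invg_exp[k expk] nozd a b c d neq_ab neq_cd.
have [g ncomm] : exists g, ~ commute (a / b) ((c / d) ^ g).
  by apply/existsNP => /nozd[/divg1_eq|/divg1_eq].
pose X (i : nat) (lt_i : (i < 4)%N) := TVar G (Ordinal lt_i).
pose U := TMul (X 0%N isT) (tpow (X 1%N isT) k).
pose V := TMul (TConst 4 g^-1)
  (TMul (TMul (X 2%N isT) (tpow (X 3%N isT) k)) (TConst 4 g)).
have evU x y z w : eval (vec4 x y z w) U = x / y.
  by rewrite /= eval_tpow expk.
have evV x y z w : eval (vec4 x y z w) V = (z / w) ^ g.
  by rewrite /= eval_tpow expk.
(* If [x = y] or [z = w], one of the two commuting elements is 1. *)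
exists (TMul U V), (TMul V U); split=> [|x y z w]; cbn [eval]; rewrite !evU !evV //.
by case=> ->; rewrite mulgV ?conj1g ?mul1g ?mulg1.
Qed.

Section ReesMatrix.
Variables (G : groupType) (Lam I : choiceType) (l1 : Lam) (i1 : I).
Variable P : I -> Lam -> G.
Hypothesis normP : normalized l1 i1 P.

Definition rees_unit (g : G) : rees P := (l1, g, i1).

Lemma rees_unitM : {morph rees_unit : g h / g * h}.
Proof.
by move=> g h; rewrite /rees_unit; congr (_, _, _); rewrite normP.1 mulg1.
Qed.

HB.instance Definition _ := isMultiplicative.Build G (rees P) rees_unit rees_unitM.

(** Multiplying [(l, g, i)] by [(l1, 1, r)] and [(k, 1, i1)] gives
    [P r l * g * P i k] in the subgroup [(l1, G, i1)].  If these
    products agree for all [r] and [k], normalization lets one read off first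
    the middle coordinates, then the rows and the columns. *)
Lemma rees_separating :
  (forall i j, P i =1 P j -> i = j) ->
  (forall l m, P^~ l =1 P^~ m -> l = m) ->
  separating G -> separating (rees P).
Proof.
move=> rowI colI; apply: (@separating_transfer _ _ rees_unit).
  by move=> g h [].
move=> [[l g] i] [[m h] j] neq.
have [[r k] neq_rk] : exists p : I * Lam,
    P p.1 l * g * P i p.2 <> P p.1 m * h * P j p.2.
  apply: contrapT => /forallNP eqP'.
  have {}eqP' r k : P r l * g * P i k = P r m * h * P j k.
    exact: contrapT (eqP' (r, k)).
  have eq_gh : g = h by have := eqP' i1 l1; rewrite !normP.1 !normP.2 !mulg1 !mul1g.
  have eq_ij : i = j.
    apply: rowI => k; have := eqP' i1 k.
    by rewrite !normP.1 !mul1g eq_gh => /mulgI.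
  have eq_lm : l = m.
    apply: colI => r; have := eqP' r l1.
    by rewrite !normP.2 !mulg1 eq_gh => /mulIg.
  by apply: neq; rewrite eq_gh eq_ij eq_lm.
pose left : rees P := (l1, 1, r); pose right : rees P := (k, 1, i1).
pose t := TMul (TMul (TConst 1 left) (TVar _ ord0)) (TConst 1 right).
have evt l' g' i' :
    eval (fun=> (l', g', i') : rees P) t = rees_unit (P r l' * g' * P i' k).
  transitivity (rees_unit (1 * P r l' * g' * P i' k * 1)); first by [].
  by rewrite mul1g mulg1.
exists t; split=> [|[[l' g'] i']]; rewrite !evt; first by case.
by exists (P r l' * g' * P i' k).
Qed.

End ReesMatrix.

(** * Obstructions from rigid terms *)

Definition vec2 (T : Type) (x y : T) (i : 'I_2) : T := if i == ord0 then x else y.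

Definition ev2 (T : semigroupType) (t : term T 2) (x y : T) : T := eval (vec2 x y) t.

(** The union of [x = a] and [y = c] contains three corners of the square and
    misses the fourth. *)
Lemma equational_domain_corner (T : semigroupType) (a b c d : T) :
  equational_domain T -> a <> b -> c <> d ->
  exists t s : term T 2, [/\ ev2 t a c = ev2 s a c, ev2 t a d = ev2 s a d,
    ev2 t b c = ev2 s b c & ev2 t b d <> ev2 s b d].
Proof.
move=> edT neq_ab neq_cd.
have /algebraicP sep := algebraicU edT
  (algebraic_eq (TVar T (ord0 : 'I_2)) (TConst 2 a))
  (algebraic_eq (TVar T (ord_max : 'I_2)) (TConst 2 c)).
have [|t [s [neq eq_ts]]] := sep (vec2 b d).
  by case=> /= [/esym|/esym].
by exists t, s; split=> //; apply: eq_ts; (by left) || by right.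
Qed.

Definition skips1 (T : Type) (f : T -> T -> T) (a b c d : T) : Prop :=
  f b d = f a d /\ f b c = f a c.
Definition skips2 (T : Type) (f : T -> T -> T) (a b c d : T) : Prop :=
  f b d = f b c /\ f a d = f a c.

(** If every term on the square forgets one of its two arguments, or takes the
    same value at [(b, c)], [(a, d)] and [(b, d)], then for any two terms there
    is a chain of equal values linking their values at [(b, d)] through the
    three corners where they agree. *)
Lemma degenerate_square_absurd (T : semigroupType) (a b c d : T) :
  equational_domain T -> a <> b -> c <> d ->
  ~ forall t : term T 2,
    [\/ skips1 (ev2 t) a b c d, skips2 (ev2 t) a b c d
      | ev2 t b d = ev2 t b c /\ ev2 t b d = ev2 t a d].
Proof.
move=> edT neq_ab neq_cd degenerate.
have [t [s [ac ad bc]]] := equational_domain_corner edT neq_ab neq_cd; apply.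
by case: (degenerate t) => -[? ?]; case: (degenerate s) => -[? ?]; congruence.
Qed.

(** Either the variable does not occur in the term, or it occurs as a factor
    and drags the value into the ideal. *)
Lemma eval_var_ideal (T : semigroupType) (J : set T) (n : nat) (i : 'I_n)
    (t : term T n) : is_ideal J ->
  (forall x y : 'I_n -> T, (forall j, j != i -> x j = y j) ->
     eval x t = eval y t) \/
  (forall x : 'I_n -> T, J (x i) -> J (eval x t)).
Proof.
move=> [_ idJ]; elim: t => [j|c|t1 [IH1|IH1] t2 [IH2|IH2]] /=.
- by case: (eqVneq j i) => [->|neq_ji]; [right | left=> x y; apply].
- by left.
- by left=> x y xy; rewrite (IH1 x y xy) (IH2 x y xy).
- by right=> x Jx; apply: (idJ _ _ (IH2 x Jx)).1.
- by right=> x Jx; apply: (idJ _ _ (IH1 x Jx)).2.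
- by right=> x Jx; apply: (idJ _ _ (IH2 x Jx)).1.
Qed.

Lemma ev2_ideal1 (T : semigroupType) (J : set T) (t : term T 2) : is_ideal J ->
  (forall x x' y, ev2 t x y = ev2 t x' y) \/ (forall x y, J x -> J (ev2 t x y)).
Proof.
move=> idJ; case: (eval_var_ideal ord0 t idJ) => [skip|Jt]; [left|right].
  by move=> x x' y; apply: skip => j; rewrite /vec2 => /negPf->.
by move=> x y; apply: (Jt (vec2 x y)).
Qed.

Lemma ev2_ideal2 (T : semigroupType) (J : set T) (t : term T 2) : is_ideal J ->
  (forall x y y', ev2 t x y = ev2 t x y') \/ (forall x y, J y -> J (ev2 t x y)).
Proof.
move=> idJ; case: (eval_var_ideal ord_max t idJ) => [skip|Jt]; [left|right].
  by move=> x y y'; apply: skip => -[[|[|]]].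
by move=> x y; apply: (Jt (vec2 x y)).
Qed.

(** On the square {a, z} x {a, z}, a term that contains both variables vanishes
    at the three corners other than [(a, a)]. *)
Lemma equational_domain_zero (T : semigroupType) (z : T) :
  equational_domain T -> (forall s, s * z = z /\ z * s = z) -> forall a, a = z.
Proof.
move=> edT zeroz a; apply: contrapT => neq.
have idz : is_ideal [set z].
  by split=> [|s _ ->]; [exists z | apply: zeroz].
apply: (degenerate_square_absurd edT neq neq) => t.
have [skip|t1z] := ev2_ideal1 t idz; first by constructor 1; split.
have [skip|t2z] := ev2_ideal2 t idz; first by constructor 2; split.
by constructor 3; rewrite (t1z z z) // (t1z z a) // (t2z a z).
Qed.

Lemma eval_mul_ideal (T : semigroupType) (J : set T) (n : nat)
    (x y : 'I_n -> T) (t : term T n) :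
  is_ideal J -> (forall i k, J k -> x i * k = y i * k) ->
  forall k, J k -> eval x t * k = eval y t * k.
Proof.
move=> [_ idJ] xy; elim: t => [i|//|t1 IH1 t2 IH2] /= k Jk; first exact: xy.
by rewrite -!mulgA (IH2 _ Jk); apply/IH1/(idJ _ _ Jk).1.
Qed.

(** In a product, replacing [a] by [b] is invisible in every factor that has a
    factor in [J] to its right.  Hence on the square {a, b} x {a, b} the value of
    a term depends at most on its last variable. *)
Lemma ideal_left_faithful_in (T : semigroupType) (J : set T) (a b : T) :
  equational_domain T -> is_ideal J -> J a -> J b ->
  (forall k, J k -> a * k = b * k) -> a = b.
Proof.
move=> edT idJ Ja Jb eq_ab; apply: contrapT => neq.
apply: (degenerate_square_absurd edT neq neq) => t.
suff: skips1 (ev2 t) a b a b \/ skips2 (ev2 t) a b a b.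
  by case; [constructor 1|constructor 2].
elim: t => [i|c|t1 IH1 t2 IH2]; [|by left|].
  by rewrite /skips1 /skips2 /ev2 /= /vec2; case: ifP; [right|left].
have Jab x : x = a \/ x = b -> J x by case=> ->.
have [const|Jt2] : (forall x y x' y', ev2 t2 x y = ev2 t2 x' y') \/
    forall x y, J x -> J y -> J (ev2 t2 x y).
  have [skip1|J1] := ev2_ideal1 t2 idJ; last by right=> x y Jx _; apply: J1.
  have [skip2|J2] := ev2_ideal2 t2 idJ; last by right=> x y _; apply: J2.
  by left=> x y x' y'; rewrite (skip1 x x') (skip2 x' y y').
  have tE x y : ev2 (TMul t1 t2) x y = ev2 t1 x y * ev2 t2 a a.
    by rewrite (const a a x y).
  by case: IH1 => -[eq1 eq2]; [left|right]; rewrite /skips1 /skips2 !tE eq1 eq2.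
have tE x y : x = a \/ x = b -> y = a \/ y = b ->
    ev2 (TMul t1 t2) x y = ev2 t1 a a * ev2 t2 x y.
  move=> xab yab; apply: (eval_mul_ideal _ idJ) => [i k Jk|]; last first.
    by apply: Jt2; apply: Jab.
  by rewrite /vec2; case: ifP => _; [case: xab|case: yab] => ->; rewrite ?eq_ab.
case: IH2 => -[eq1 eq2]; [left|right]; rewrite /skips1 /skips2;
  by rewrite !tE ?eq1 ?eq2; auto.
Qed.

(** If [J] has distinct elements [c] and [d], consider the square
    {a, b} x {c, d}: a term containing the second variable has values in [J],
    where [ideal_left_faithful_in] shows that [a] and [b] are interchangeable.  If
    [J] is a singleton, it is a zero and the semigroup is trivial. *)
Lemma ideal_left_faithful (T : semigroupType) (J : set T) (a b : T) :
  equational_domain T -> is_ideal J ->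
  (forall k, J k -> a * k = b * k) -> a = b.
Proof.
move=> edT idJ eq_ab; have [[c Jc] Jmul] := idJ; apply: contrapT => neq.
have [[d [Jd neq_cd]]|trivJ] := pselect (exists d, J d /\ c <> d).
  apply: (degenerate_square_absurd edT neq neq_cd) => t.
  have [skip|Jt] := ev2_ideal2 t idJ; first by constructor 2; split.
  have eq_t y : J y -> ev2 t a y = ev2 t b y.
    move=> Jy; apply: (ideal_left_faithful_in edT idJ (Jt _ _ Jy) (Jt _ _ Jy)).
    apply: eval_mul_ideal => // i k Jk.
    by rewrite /vec2; case: ifP => // _; apply: eq_ab.
  by constructor 1; rewrite /skips1 !eq_t.
have {}trivJ d : J d -> d = c.
  by move=> Jd; apply: contrapT => neq_dc; apply: trivJ; exists d; split=> // /esym.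
have zeroc s : s * c = c /\ c * s = c.
  by have [? ?] := Jmul s c Jc; split; apply: trivJ.
by apply: neq; rewrite (equational_domain_zero edT zeroc a)
  (equational_domain_zero edT zeroc b).
Qed.

(** * The opposite semigroup *)

(** An alias carrying the reversed product, which turns statements about left
    factors into statements about right factors. *)
Definition opposite (T : Type) : Type := T.

Section Opposite.
Variable T : semigroupType.

HB.instance Definition _ := Choice.on (opposite T).

Definition opposite_mul (x y : opposite T) : opposite T := (y : T) * (x : T).

Lemma opposite_mulA : associative opposite_mul.
Proof. by move=> x y z; rewrite /opposite_mul mulgA. Qed.

HB.instance Definition _ := isSemigroup.Build (opposite T) opposite_mulA.

End Opposite.

Fixpoint mirror (T : Type) (n : nat) (t : term T n) : term T n :=
  match t with
  | TMul t1 t2 => TMul (mirror t2) (mirror t1)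
  | _ => t
  end.

Lemma eval_mirror (T : semigroupType) (n : nat) (x : 'I_n -> T) (t : term T n) :
  @eval (opposite T) n x (mirror t) = eval x t.
Proof. by elim: t => //= t1 IH1 t2 IH2; rewrite -IH1 -IH2. Qed.

Lemma eval_mirror_opposite (T : semigroupType) (n : nat) (x : 'I_n -> T)
    (t : term T n) :
  @eval T n x (mirror t) = @eval (opposite T) n x t.
Proof. by elim: t => //= t1 IH1 t2 IH2; rewrite IH1 IH2. Qed.

Lemma opposite_algebraic (T : semigroupType) (n : nat) (Y : set ('I_n -> T)) :
  @algebraic (opposite T) n Y <-> @algebraic T n Y.
Proof.
split=> /algebraicP sep; apply/algebraicP => x /sep[t [s [neq eq_ts]]];
  exists (mirror t), (mirror s).
  by split=> [|y /eq_ts]; rewrite !eval_mirror_opposite.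
by split=> [|y /eq_ts]; rewrite !eval_mirror.
Qed.

Lemma opposite_equational_domain (T : semigroupType) :
  equational_domain T -> equational_domain (opposite T).
Proof.
move=> edT n m Y m_gt0 algY; apply/opposite_algebraic.
by apply: edT => // j; apply/opposite_algebraic/algY.
Qed.

Lemma ideal_right_faithful (T : semigroupType) (J : set T) (a b : T) :
  equational_domain T -> is_ideal J ->
  (forall k, J k -> k * a = k * b) -> a = b.
Proof.
move=> /opposite_equational_domain edT [J0 Jmul].
apply: (@ideal_left_faithful (opposite T) J) => //.
by split=> // s x Jx; have [] := Jmul s x Jx.
Qed.

(** * Semigroups with a Rees matrix ideal *)

Section ReesIdeal.
Variables (S : semigroupType) (K : set S) (G : groupType) (Lam I : choiceType).
Variables (l1 : Lam) (i1 : I) (P : I -> Lam -> G).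
Variable phi : {multiplicative rees P -> S}.
Hypotheses (idK : is_ideal K) (normP : normalized l1 i1 P).
Hypotheses (injphi : injective phi) (imphi : range phi = K).

Lemma phi_ideal x : K (phi x).
Proof. by rewrite -imphi; exists x. Qed.

Lemma ideal_phi k : K k -> exists x, k = phi x.
Proof. by rewrite -imphi => -[x _ <-]; exists x. Qed.

(** With equal rows [i] and [j], the elements [(l1, 1, i)] and [(l1, 1, j)] act
    equally on the ideal from the left. *)
Lemma equational_domain_rows : equational_domain S ->
  forall i j, P i =1 P j -> i = j.
Proof.
move=> edS i j eqP'.
suff /injphi[] : phi ((l1, 1, i) : rees P) = phi ((l1, 1, j) : rees P) by [].
apply: (ideal_left_faithful edS idK) => k /ideal_phi[[[m h] r] ->].
rewrite -!gmulfM; congr (phi _); transitivity ((l1, 1 * P i m * h, r) : rees P) => //.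
by rewrite eqP'.
Qed.

Lemma equational_domain_columns : equational_domain S ->
  forall l m, P^~ l =1 P^~ m -> l = m.
Proof.
move=> edS l m eqP'.
suff /injphi[] : phi ((l, 1, i1) : rees P) = phi ((m, 1, i1) : rees P) by [].
apply: (ideal_right_faithful edS idK) => k /ideal_phi[[[r h] j] ->].
rewrite -!gmulfM; congr (phi _); transitivity ((r, h * P j l * 1, i1) : rees P) => //.
by rewrite (eqP' j).
Qed.

(** A left translation moves the left coordinate and multiplies the middle one
    by a factor that depends on the left coordinate alone: it commutes with
    the right multiplications by elements of the ideal, which reach every
    middle and right coordinate. *)
Lemma ideal_left_action (s : S) l : exists m f, forall g i,
  s * phi ((l, g, i) : rees P) = phi ((m, f * g, i) : rees P).
Proof.
have /ideal_phi[[[m f] j] sE] := (idK.2 s _ (phi_ideal (l, 1, i1))).1.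
exists m, f => g i.
have -> : ((l, g, i) : rees P) = ((l, 1, i1) : rees P) * ((l1, g, i) : rees P).
  by congr (_, _, _); rewrite normP.1 !mul1g.
rewrite gmulfM mulgA sE -gmulfM; congr (phi _).
by congr (_, _, _); rewrite normP.2 mulg1.
Qed.

Lemma ideal_right_action (s : S) i : exists j f, forall l g,
  phi ((l, g, i) : rees P) * s = phi ((l, g * f, j) : rees P).
Proof.
have /ideal_phi[[[m f] j] sE] := (idK.2 s _ (phi_ideal (l1, 1, i))).2.
exists j, f => l g.
have -> : ((l, g, i) : rees P) = ((l, g, i1) : rees P) * ((l1, 1, i) : rees P).
  by congr (_, _, _); rewrite normP.1 !mulg1.
rewrite gmulfM -mulgA sE -gmulfM; congr (phi _).
by congr (_, _, _); rewrite normP.1 mulg1.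
Qed.

Section ZeroDivisors.
Variables (u v : G).
Hypothesis comm_uv : forall g, commute u (v ^ g).

(** [normal_left] is the centralizer of the normal closure of [v], and
    [normal_right] the centralizer of [normal_left].  They are normal subgroups
    centralizing each other and containing [u] and [v] respectively. *)
Definition normal_left (x : G) := forall g, commute x (v ^ g).
Definition normal_right (y : G) := forall x, normal_left x -> commute x y.

Lemma commuteJ (x y g : G) : commute x (y ^ g^-1) -> commute (x ^ g) y.
Proof.
move=> xy; suff : (x * y ^ g^-1) ^ g = (y ^ g^-1 * x) ^ g.
  by rewrite conjMg (conjMg _ x) conjgKV.
by rewrite xy.
Qed.

Lemma normal_left1 : normal_left 1.
Proof. by move=> g; apply/commute_sym/commute1. Qed.

Lemma normal_leftM x y : normal_left x -> normal_left y -> normal_left (x * y).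
Proof.
by move=> lx ly g; apply/commute_sym/commuteM; apply/commute_sym.
Qed.

Lemma normal_leftJ x g : normal_left x -> normal_left (x ^ g).
Proof. by move=> lx h; apply: commuteJ; rewrite -conjgM. Qed.

Lemma normal_right1 : normal_right 1.
Proof. by move=> g _; apply: commute1. Qed.

Lemma normal_rightM x y : normal_right x -> normal_right y -> normal_right (x * y).
Proof. by move=> rx ry z lz; apply: commuteM; [apply: rx|apply: ry]. Qed.

Lemma normal_rightJ y g : normal_right y -> normal_right (y ^ g).
Proof.
move=> ry x lx; apply/commute_sym/commuteJ/commute_sym.
exact/ry/normal_leftJ.
Qed.

Let unit (g : G) : S := phi (rees_unit l1 i1 P g).

(** Replacing 1 by [u] in the first argument multiplies the middle coordinate by
    some [x], and replacing 1 by [v] in the second one multiplies it by some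
    [y], independently of each other; thus three corners determine the fourth. *)
Definition affine (t : term S 2) := exists l j g x y,
  [/\ normal_left x, normal_right y &
  [/\ ev2 t (unit 1) (unit 1) = phi ((l, g, j) : rees P),
      ev2 t (unit u) (unit 1) = phi ((l, x * g, j) : rees P),
      ev2 t (unit 1) (unit v) = phi ((l, y * g, j) : rees P) &
      ev2 t (unit u) (unit v) = phi ((l, x * y * g, j) : rees P)]].

(** Affinity survives products because the factors [x] and [y] can be moved to the
    front at the cost of a conjugation, which preserves the two normal
    subgroups, and then sorted, as these subgroups commute. *)
Lemma const_or_affine (t : term S 2) :
  (exists c, forall x y, ev2 t x y = c) \/ affine t.
Proof.
elim: t => [i|c|t1 IH1 t2 IH2].
- right; exists l1, i1, 1.
  have [->|neq_i0] := eqVneq i ord0.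
    exists u, 1; split=> //; first exact: normal_right1.
    by rewrite /ev2 /= /unit /rees_unit !mulg1.
  exists 1, v; split=> //; first exact: normal_left1.
    by move=> x /(_ 1); rewrite conjg1.
  by rewrite /ev2 /= /vec2 (negPf neq_i0) /unit /rees_unit !mulg1 !mul1g.
- by left; exists c.
have tE x y : ev2 (TMul t1 t2) x y = ev2 t1 x y * ev2 t2 x y by [].
case: IH1 => [[c1 c1E]|[l [j [g [x [y [lx ry [E1 E2 E3 E4]]]]]]]];
case: IH2 => [[c2 c2E]|[m [k [h [z [w [lz rw [F1 F2 F3 F4]]]]]]]].
- by left; exists (c1 * c2) => a b; rewrite tE c1E c2E.
- right; have [l [f actE]] := ideal_left_action c1 m.
  exists l, k, (f * h), (z ^ f^-1), (w ^ f^-1).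
  split; [exact: normal_leftJ|exact: normal_rightJ|].
  by rewrite !tE !c1E F1 F2 F3 F4 !actE !conjgE !invgK !mulgA !mulgVK.
- right; have [k [f actE]] := ideal_right_action c2 j.
  exists l, k, (g * f), x, y; split=> //.
  by rewrite !tE !c2E E1 E2 E3 E4 !actE !mulgA.
right.
(* [p] is what the factors coming from [t2] must cross to reach the front. *)
pose p := g * P j m.
exists l, k, (p * h), (x * z ^ p^-1), (y * w ^ p^-1).
have lz' := normal_leftJ p^-1 lz; have rw' := normal_rightJ p^-1 rw.
split; [exact: normal_leftM|exact: normal_rightM|].
have mulE g1 g2 : phi ((l, g1, j) : rees P) * phi ((m, g2, k) : rees P) =
    phi ((l, g1 * P j m * g2, k) : rees P) by rewrite -gmulfM.
have pE e : e * g * P j m = e * p by rewrite /p mulgA.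
have moveE (e r f q : G) : e * r * (f * q) = e * f ^ r^-1 * (r * q).
  by rewrite conjgE invgK !mulgA mulgVK.
have xyzw : x * y * (z * w) ^ p^-1 = x * z ^ p^-1 * (y * w ^ p^-1).
  rewrite (conjMg z w); move: (z ^ p^-1) (w ^ p^-1) lz' => z' w' /ry comm_z'y.
  by rewrite !mulgA -(mulgA x y) -comm_z'y mulgA.
rewrite !tE E1 E2 E3 E4 F1 F2 F3 F4 !mulE.
by split; rewrite // pE moveE // xyzw.
Qed.

Lemma equational_domain_zero_divisors :
  equational_domain S -> u = 1 \/ v = 1.
Proof.
move=> edS; apply: contrapT => /not_orP[u1 v1].
have unit_inj g h : unit g = unit h -> g = h by move/injphi => [].
have [||t [s [ac ad bc]]] :=
  @equational_domain_corner S (unit 1) (unit u) (unit 1) (unit v) edS.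
- by move/unit_inj/esym.
- by move/unit_inj/esym.
have phi_inj l g j m h k : phi ((l, g, j) : rees P) = phi ((m, h, k) : rees P) ->
  [/\ l = m, g = h & j = k] by move/injphi => [-> -> ->].
apply.
(* If only one of the terms is constant, the other has trivial factors. *)
have mulg_id (x g : G) : g = x * g -> x = 1.
  by move=> /esym eq_g; apply: (mulIg g); rewrite mul1g.
case: (const_or_affine t) => [[c1 c1E]|[l [j [g [x [y [lx ry [E1 E2 E3 E4]]]]]]]];
case: (const_or_affine s) => [[c2 c2E]|[m [k [h [z [w [lz rw [F1 F2 F3 F4]]]]]]]].
- by move: ac; rewrite !c1E !c2E.
- rewrite c1E F4; move: ac ad bc; rewrite !c1E F1 F2 F3 => ->.
  by move=> /phi_inj[_ /mulg_id-> _] /phi_inj[_ /mulg_id-> _]; rewrite !mul1g.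
- rewrite c2E E4; move: ac ad bc; rewrite !c2E E1 E2 E3 => <-.
  move=> /esym/phi_inj[_ /mulg_id-> _] /esym/phi_inj[_ /mulg_id-> _].
  by rewrite !mul1g.
move: ac ad bc; rewrite E1 E2 E3 E4 F1 F2 F3 F4.
by move=> /phi_inj[-> -> ->] /phi_inj[_ /mulIg-> _] /phi_inj[_ /mulIg-> _].
Qed.

End ZeroDivisors.

End ReesIdeal.

Unset Implicit Arguments.

(** * Equational domains and their finite kernels *)

(* [phi] is the identification of the kernel [K] with its Rees coordinates. *)
Theorem theorem6p3 (S : semigroupType) (K : set S)
    (G : groupType) (Lam I : choiceType) (l1 : Lam) (i1 : I)
    (P : I -> Lam -> G) (phi : {multiplicative rees P -> S}) :
  is_kernel K -> finite_set K ->
  normalized l1 i1 P -> injective phi -> range phi = K ->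
  equational_domain S <->
    (equational_domain (rees P) /\
     (forall a b : S, simK K a b -> a = b)).
Proof.
move=> [idK _] finK normP injphi imphi; split=> [edS | [edK trivK]].
  split=> [|a b ab]; last first.
    by apply: (ideal_left_faithful edS idK) => k /ab[].
  have finG : finite_set [set: G].
    pose e (g : G) := phi (rees_unit l1 i1 P g).
    have -> : [set: G] = e @^-1` K.
      by apply/seteqP; split=> g _ //; apply: phi_ideal imphi _.
    by apply: finite_preimage finK => g h _ _ /injphi[].
  apply/separating_equational_domain/(rees_separating normP).
  - exact: equational_domain_rows idK injphi imphi edS.
  - exact: equational_domain_columns idK injphi imphi edS.
  apply: finite_group_separating finG _ => u v uv.
  exact: (equational_domain_zero_divisors idK normP injphi imphi uv edS).
apply/separating_equational_domain/(separating_transfer injphi) => [a b neq|].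
  have [k [Kk neq_k]] : exists k, K k /\ ~ (a * k = b * k /\ k * a = k * b).
    apply: contrapT => noK; apply/neq/trivK => k Kk.
    by apply: contrapT => neq_k; apply: noK; exists k.
  have [eq_k|neq_ak] := pselect (a * k = b * k).
    exists (TMul (TConst 1 k) (TVar _ ord0)).
    split=> [/= eq_k'|x]; first exact: neq_k.
    by rewrite imphi; apply: (idK.2 _ _ Kk).2.
  exists (TMul (TVar _ ord0) (TConst 1 k)).
  by split=> // x; rewrite imphi; apply: (idK.2 _ _ Kk).1.
exact: equational_domain_separating.
Qed.
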